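(* Let $a<0$, and for $b\in\mathbb{R}$ put $c=-b/a$. Let $h_F(c)$ denote the topological entropy of the restriction of $F_{a,b}(x,y)=(|x|-y+a,\;x-|y|+b)$ to its compact invariant graph $\Gamma_{a,b}$ (this entropy depends on $(a,b)$ only through $c$). Then the function $c\mapsto h_F(c)$ is continuous at $c=8$.
   Context: For $(a,b)\in\mathbb{R}^2$, $F_{a,b}:\mathbb{R}^2\to\mathbb{R}^2$ is $F_{a,b}(x,y)=(|x|-y+a,\;x-|y|+b)$. For $\lambda>0$ one has $\lambda F_{a,b}(x/\lambda,y/\lambda)=F_{\lambda a,\lambda b}(x,y)$, so for $a<0$ the map $F_{a,b}$ is conjugate to $F_{-1,c}$ with $c=-b/a$, by a homothety. For $a<0$ there is a compact graph $\Gamma_{a,b}\subset\mathbb{R}^2$ (a finite union of segments) with $F_{a,b}(\Gamma_{a,b})\subset\Gamma_{a,b}$ into which every orbit eventually enters, except possibly those that land on certain exceptional fixed points or periodic orbits. One has $\Gamma_{a,b}=|a|\,\Gamma_{-1,c}$. For the values of $c$ relevant to continuity at $8$ (namely $c>4$), writing $b$ for $c$, the graph $\Gamma_{-1,b}$ is explicitly the union of the five closed segments $$\overline{P_3P_{11}},\quad \overline{P_3P_5},\quad \overline{P_6P_8},\quad \overline{P_8P_{10}},\quad \overline{P_9P_{11}},$$ where $P_3=(-b-2,-1)$, $P_5=(b,-1)$, $P_6=(b+2,-3)$, $P_8=(0,b-1)$, $P_9=(b+4,2b-1)$, $P_{10}=(b,2b-1)$, $P_{11}=(b-2,2b-1)$.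 Topological entropy is the usual topological entropy of a continuous self-map of a compact metric space. *)

(* Defs.v *)
From HB Require Import structures.
From mathcomp Require Import all_boot all_order all_algebra finmap.
From mathcomp Require Import all_classical all_reals all_analysis.

Set Implicit Arguments.
Unset Strict Implicit.
Unset Printing Implicit Defensive.

Import Order.TTheory GRing.Theory Num.Theory.
Import numFieldNormedType.Exports.

Local Open Scope classical_set_scope.
Local Open Scope ring_scope.

(* Topological entropy of the restriction [f : K -> K] of a map to a compact
   set [K] with [f @` K `<=` K], in the (n, eps)-separated sets form, for the
   metric of the ambient normed space (the entropy does not depend on the
   choice of a compatible metric on [K]). *)
Section TopologicalEntropy.
Context {R : realType} {T : normedModType R}.
Implicit Types (f : T -> T) (K : set T).

Definition bowen_dist f (n : nat) (x y : T) : R :=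
  \big[Num.max/0]_(i < n) `|iter i f x - iter i f y|.

Definition separated f (n : nat) (eps : R) (E : {fset T}) : Prop :=
  forall x y, x \in E -> y \in E -> x != y -> eps < bowen_dist f n x y.

Definition sep_number f K (n : nat) (eps : R) : \bar R :=
  ereal_sup [set (#|` E|%:R)%:E | E in
    [set E : {fset T} | [set` E] `<=` K /\ separated f n eps E]].

(* [entropy_at f K eps] is nonincreasing in [eps], so that its limit as
   [eps --> 0^'+] is its supremum over [0 < eps]. *)
Definition entropy_at f K (eps : R) : \bar R :=
  limn_esup (fun n => (n%:R^-1)%:E * lne (sep_number f K n eps))%E.

Definition topological_entropy f K : \bar R :=
  ereal_sup [set entropy_at f K eps | eps in [set eps : R | 0 < eps]].

End TopologicalEntropy.

Section PlanarMap.
Context {R : realType}.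
Implicit Types (a b : R) (p q : R * R).

Definition F a b p : R * R := (`|p.1| - p.2 + a, p.1 - `|p.2| + b).

Definition segment p q : set (R * R) :=
  [set (1 - t) *: p + t *: q | t in `[0, 1]].

Definition P3  b : R * R := (- b - 2, -1).
Definition P5  b : R * R := (b, -1).
Definition P6  b : R * R := (b + 2, -3).
Definition P8  b : R * R := (0, b - 1).
Definition P9  b : R * R := (b + 4, 2 * b - 1).
Definition P10 b : R * R := (b, 2 * b - 1).
Definition P11 b : R * R := (b - 2, 2 * b - 1).

(* The invariant graph of [F (-1) b]; these segments describe it only for
   [4 < b]. *)
Definition normalized_graph b : set (R * R) :=
  segment (P3 b) (P11 b) `|` segment (P3 b) (P5 b) `|`
  segment (P6 b) (P8 b) `|` segment (P8 b) (P10 b) `|`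
  segment (P9 b) (P11 b).

(* The invariant graph of [F a b], for [a < 0] and [4 < - b / a]. *)
Definition graph a b : set (R * R) :=
  [set `|a| *: p | p in normalized_graph (- b / a)].

End PlanarMap.

(* Main.v *)
(* The entropy is 0 at c = 8, so only an upper bound near 8 is needed.  The
   map is affine on each closed quadrant.  On the points of a segment whose
   first n iterates follow a given word of quadrants, the iterates are affine,
   so that an (n, eta)-separated set has at most O(n / eta) points there.  The
   entropy is thus at most the exponential growth rate of the number of words,
   which is submultiplicative: it suffices to find, for c close to 8, a time m
   after which the number of words is still polynomial in m.

   The dynamics is read off the first returns to the line y = x + c + 1,
   parametrized by v = x + c + 2 in [0, 2c].  The return map is 6 - 4v on
   [0, 1], constant on [1, c/2 + 1] with value 2 in that same interval,
   4v - 2c - 2 on [c/2 + 1, c + 1/2], 4v - 4c - 2 on [c + 1/2, c + 2] and 0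
   beyond.  Points entering a constant piece have a single future.  Points
   returning through [c + 1/2, c + 2] land in [0, 6], and for c = 8 the point
   6 is the repelling fixed point of the third branch, below which every orbit
   falls into the trap around 2.  For c close to 8, a point below 6 needs about
   log(1 / |c - 8|) returns to get away from this fixed point, so that up to
   any given time there is at most one passage through [c + 1/2, c + 2]. *)
Require Import Defs.
From mathcomp Require Import all_boot all_order all_algebra.
From mathcomp Require Import all_classical all_reals all_analysis.
From mathcomp Require Import finmap ring lra zify.
Import Order.TTheory GRing.Theory Num.Theory.
Import numFieldNormedType.Exports.
Local Open Scope classical_set_scope.
Local Open Scope ring_scope.

Set Implicit Arguments.
Unset Strict Implicit.
Unset Printing Implicit Defensive.

(** * Itineraries through the closed quadrants and the number of words *)

Section Words.
Context {R : realType} (a b : R).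
Implicit Types (p q d : R * R) (S T : set (R * R)) (w : seq (bool * bool)).

Definition in_quadrant (o : bool * bool) p : Prop :=
  (if o.1 then 0 <= p.1 else p.1 <= 0) /\ (if o.2 then 0 <= p.2 else p.2 <= 0).

(** The derivative of [F a b] on the quadrant [o]. *)
Definition quadrant_linear (o : bool * bool) d : R * R :=
  ((if o.1 then d.1 else - d.1) - d.2, d.1 - (if o.2 then d.2 else - d.2)).

Lemma F_quadrant o p q : in_quadrant o p -> in_quadrant o q ->
  F a b p - F a b q = quadrant_linear o (p - q).
Proof.
case: o p q => [[] []] [p1 p2] [q1 q2]; rewrite /in_quadrant /= => -[h1 h2] [h3 h4];
  apply/pair_equal_spec; split=> /=;
  rewrite ?(ger0_norm h1) ?(ler0_norm h1) ?(ger0_norm h2) ?(ler0_norm h2)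
          ?(ger0_norm h3) ?(ler0_norm h3) ?(ger0_norm h4) ?(ler0_norm h4); lra.
Qed.

Lemma quadrant_linearZ o t d :
  quadrant_linear o (t *: d) = t *: quadrant_linear o d.
Proof.
case: o d => [[] []] [d1 d2]; apply/pair_equal_spec; split; rewrite /= /GRing.scale /=; lra.
Qed.

Lemma in_some_quadrant p : exists o, in_quadrant o p.
Proof.
exists (0 <= p.1, 0 <= p.2); rewrite /in_quadrant /=.
by split; case: ifPn => //; rewrite -ltNge => /ltW.
Qed.

Fixpoint follows w p : Prop :=
  if w is o :: w' then in_quadrant o p /\ follows w' (F a b p) else True.

Lemma follows_cat w1 w2 p :
  follows w1 p -> follows w2 (iter (size w1) (F a b) p) -> follows (w1 ++ w2) p.
Proof.
elim: w1 p => [//|o w1 IH] p /= [? ?]; rewrite -iterS iterSr => ?.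
by split=> //; exact: IH.
Qed.

Lemma follows_take n w p : follows w p -> follows (take n w) p.
Proof.
by elim: w n p => [|o w IH] [|n] p //= [? ?]; split=> //; exact: IH.
Qed.

Lemma iter_follows w p q d t i : follows w p -> follows w q ->
  p - q = t *: d -> (i <= size w)%N ->
  iter i (F a b) p - iter i (F a b) q =
    t *: foldl (fun e o => quadrant_linear o e) d (take i w).
Proof.
elim: w p q d i => [|o w IH] p q d [|i] //= [op wp] [oq wq] pq iw.
rewrite -!iterS !iterSr; apply: IH => //.
by rewrite (F_quadrant op oq) pq quadrant_linearZ.
Qed.

(** Closed quadrants overlap, so a point may follow several words; listing one of them per point
    spares any discussion of the axes. *)
Definition covered S (n k : nat) : Prop :=
  exists L : seq (seq (bool * bool)),
    [/\ (size L <= k)%N, forall w, w \in L -> size w = n &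
        forall p, S p -> exists2 w, w \in L & follows w p].

Lemma covered_sub S T n k : S `<=` T -> covered T n k -> covered S n k.
Proof. by move=> ST [L [? ? h]]; exists L; split=> // p /ST; exact: h. Qed.

Lemma covered_leq_card S n k k' : (k <= k')%N -> covered S n k -> covered S n k'.
Proof.
by move=> kk' [L [? ? ?]]; exists L; split=> //; exact: leq_trans kk'.
Qed.

Lemma covered_leq_time S n n' k : (n <= n')%N -> covered S n' k -> covered S n k.
Proof.
move=> nn' [L [Lk Ln LS]]; exists (map (take n) L); split.
- by rewrite size_map.
- by move=> _ /mapP[w /Ln wn ->]; rewrite size_takel// wn.
- move=> p /LS[w wL wp]; exists (take n w); first exact: map_f.
  exact: follows_take.
Qed.

Lemma coveredU S T n k l :
  covered S n k -> covered T n l -> covered (S `|` T) n (k + l).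
Proof.
move=> [L [Lk Ln LS]] [M [Mk Mn MT]]; exists (L ++ M); split.
- by rewrite size_cat leq_add.
- by move=> w; rewrite mem_cat => /orP[/Ln|/Mn].
- by move=> p [/LS|/MT] [w wL wp]; exists w; rewrite // mem_cat wL ?orbT.
Qed.

Lemma covered_step_succ o S T n k :
  (forall p, S p -> in_quadrant o p /\ T (F a b p)) ->
  covered T n k -> covered S n.+1 k.
Proof.
move=> ST [L [Lk Ln LT]]; exists (map (cons o) L); split.
- by rewrite size_map.
- by move=> _ /mapP[w /Ln wn ->] /=; rewrite wn.
- move=> p /ST[op /LT[w wL wp]]; exists (o :: w) => //; exact: map_f.
Qed.

Lemma covered_step o S T n k : (forall p, S p -> in_quadrant o p /\ T (F a b p)) ->
  covered T n k -> covered S n k.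
Proof.
by move=> ST cT; apply: covered_leq_time (covered_step_succ ST cT).
Qed.

Lemma covered_point p n : covered [set p] n 1.
Proof.
suff: exists2 w, size w = n & follows w p.
  move=> [w wn wp]; exists [:: w]; split=> // [v|q ->]; first by rewrite inE => /eqP ->.
  by exists w; rewrite ?inE.
elim: n p => [|n IH] p; first by exists [::].
have [ o op] := in_some_quadrant p; have [w wn wp] := IH (F a b p).
by exists (o :: w); rewrite /= ?wn.
Qed.

Lemma covered0 S : covered S 0 1.
Proof. by exists [:: [::]]; split=> // [w|p _]; [rewrite inE => /eqP ->|exists [::]]. Qed.

Lemma iter_stable S i p : (forall p, S p -> S (F a b p)) -> S p ->
  S (iter i (F a b) p).
Proof. by move=> FS Sp; elim: i => //= i; exact: FS. Qed.

Lemma covered_add S n m k l : (forall p, S p -> S (F a b p)) ->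
  covered S n k -> covered S m l -> covered S (n + m) (k * l).
Proof.
move=> FS [L [Lk Ln LS]] [M [Mk Mn MS]].
exists [seq w ++ v | w <- L, v <- M]; split.
- by rewrite size_allpairs leq_mul.
- by move=> _ /allpairsP[[w v] /= [/Ln wn /Mn vn ->]]; rewrite size_cat wn vn.
- move=> p Sp; have [w wL wp] := LS _ Sp.
  have [v vM vp] := MS _ (iter_stable (size w) FS Sp).
  exists (w ++ v); last exact: follows_cat.
  by apply/allpairsP; exists (w, v).
Qed.

Lemma covered_mul S m k j : (forall p, S p -> S (F a b p)) ->
  covered S m k -> covered S (j * m) (k ^ j).
Proof.
move=> FS c; elim: j => [|j IH]; first exact: covered0.
by rewrite mulSn expnS; exact: covered_add.
Qed.

End Words.

(** * Images of the pieces of the graph and their words for b close to 8 *)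

Section Pieces.
Context {R : realType} (b : R).
Hypothesis b_near8 : `|b - 8| <= 1 / 4.
Implicit Types (l u r : R) (p : R * R).

Definition line (s c l u : R) : set (R * R) :=
  [set p | p.2 = s * p.1 + c /\ l <= p.1 <= u].

(* The lines carrying, in this order, the segments [P3 P11], [P3 P5],
   [P6 P8], [P8 P10] and [P9 P11] of the graph, parametrized by abscissa. *)
Definition lineA := line 1 (b + 1).
Definition lineB := line 0 (-1).
Definition lineC := line (-1) (b - 1).
Definition lineD := line 1 (b - 1).
Definition lineE := line 0 (2 * b - 1).

Lemma b_bounds : 8 - 1 / 4 <= b <= 8 + 1 / 4.
Proof. by move: b_near8; rewrite ler_norml => /andP[h1 h2]; apply/andP; split; lra. Qed.

Lemma line_split s c l v u : line s c l u `<=` line s c l v `|` line s c v u.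
Proof.
move=> [x y] [/= -> /andP[lp pu]]; case: (leP x v) => h; [left|right]; split=> //;
  by rewrite ?lp ?h ?pu ?(ltW h).
Qed.

Lemma line_sub s c l u l' u' : l' <= l -> u <= u' -> line s c l u `<=` line s c l' u'.
Proof.
by move=> ll' uu' [x y] [/= -> /andP[lp pu]]; split=> //=; rewrite (le_trans ll' lp) (le_trans pu uu').
Qed.

Ltac step :=
  case=> [x y]; rewrite /= /in_quadrant /F /lineA /lineB /lineC /lineD /lineE /line /=;
  have /andP[b1 b2] := b_bounds; move=> [-> /andP[h1 h2]]; split;
  [split; lra|];
  repeat match goal with |- context [Num.norm ?z] =>
    first [rewrite (@ger0_norm _ z); last by lra
          |rewrite (@ler0_norm _ z); last by lra] end;
  split; [lra|apply/andP; split; lra].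

(** Each piece stays in one quadrant, so its image is again a piece of a line. On a line of slope 1
    in the first quadrant [x - y] is constant and the image is a single point, as in [step_AA] and
    [step_DA]. *)
Lemma step_AC l u : - b - 2 <= l -> u <= - b - 1 -> forall p, lineA l u p ->
  in_quadrant (false, false) p /\ lineC (- 2 * u - b - 2) (- 2 * l - b - 2) (F (-1) b p).
Proof. by move=> ? ?; step. Qed.

Lemma step_AB l u : - b - 1 <= l -> u <= 0 -> forall p, lineA l u p ->
  in_quadrant (false, true) p /\ lineB (- 2 * u - b - 2) (- 2 * l - b - 2) (F (-1) b p).
Proof. by move=> ? ?; step. Qed.

Lemma step_AA l u : 0 <= l -> forall p, lineA l u p ->
  in_quadrant (true, true) p /\ lineA (- b - 2) (- b - 2) (F (-1) b p).
Proof. by move=> ?; step. Qed.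

Lemma step_BC l u : u <= 0 -> forall p, lineB l u p ->
  in_quadrant (false, false) p /\ lineC (- u) (- l) (F (-1) b p).
Proof. by move=> ?; step. Qed.

Lemma step_BD l u : 0 <= l -> forall p, lineB l u p ->
  in_quadrant (true, false) p /\ lineD l u (F (-1) b p).
Proof. by move=> ?; step. Qed.

Lemma step_CA l u : 0 <= l -> u <= b - 1 -> forall p, lineC l u p ->
  in_quadrant (true, true) p /\ lineA (2 * l - b) (2 * u - b) (F (-1) b p).
Proof. by move=> ? ?; step. Qed.

Lemma step_CE l u : b - 1 <= l -> forall p, lineC l u p ->
  in_quadrant (true, false) p /\ lineE (2 * l - b) (2 * u - b) (F (-1) b p).
Proof. by move=> ?; step. Qed.

Lemma step_DA l u : 0 <= l -> forall p, lineD l u p ->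
  in_quadrant (true, true) p /\ lineA (- b) (- b) (F (-1) b p).
Proof. by move=> ?; step. Qed.

Lemma step_EA l u : 0 <= l -> forall p, lineE l u p ->
  in_quadrant (true, true) p /\ lineA (l - 2 * b) (u - 2 * b) (F (-1) b p).
Proof. by move=> ?; step. Qed.

Notation cov := (covered (-1) b).

Lemma covered_line_point s c l n : cov (line s c l l) n 1.
Proof.
apply: (@covered_sub _ _ _ _ [set (l, s * l + c)]); last exact: covered_point.
move=> [x y] [/= -> /andP[h1 h2]].
by have -> : x = l by apply/eqP; rewrite eq_le h1 h2.
Qed.

Lemma covered_line_split s c l v u n k k' :
  cov (line s c l v) n k -> cov (line s c v u) n k' -> cov (line s c l u) n (k + k').
Proof. by move=> h h'; apply: covered_sub (coveredU h h'); exact: line_split. Qed.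

Lemma covered_D l u n : 0 <= l -> cov (lineD l u) n 1.
Proof. by move=> l0; apply: (covered_step (step_DA l0)); exact: covered_line_point. Qed.

Lemma covered_A_right u n : cov (lineA 0 u) n 1.
Proof. by apply: (covered_step (step_AA (lexx 0))); exact: covered_line_point. Qed.

(* Three steps collapse this piece to one of its points. *)
Lemma covered_A_trap n : cov (lineA (- b - 1) (- b / 2 - 1)) n 1.
Proof.
have /andP[b1 b2] := b_bounds.
apply: covered_step; first by apply: step_AB; lra.
apply: covered_step; first by apply: step_BD; lra.
by apply: covered_D; lra.
Qed.

(* [- (b + 4) / 3] is the abscissa of a fixed point of the third iterate on
   [lineA], which expands distances to it by 4; all orbits that start below
   it end up in the trap.  Those that start above it by at most [4 ^- j]
   have not gone anywhere else after [3 * j] steps. *)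
Lemma covered_A_below j r : 0 <= r -> r * 4 ^+ j <= 1 ->
  cov (lineA (- b / 2 - 1) (- (b + 4) / 3 + r)) (3 * j) j.+1.
Proof.
have /andP[b1 b2] := b_bounds.
elim: j r => [|j IH] r r0 rj; first exact: covered0.
(* Keeps the piece to the left of [- 3 / 2], where the branch [4v - 2c - 2] ends. *)
have r1 : r <= 1.
  by apply: le_trans rj; rewrite ler_peMr// exprn_ege1//; lra.
rewrite mulnS -[3%N]/(1 + (1 + 1))%N -!addnA !add1n.
apply: covered_step_succ; first by apply: step_AB; lra.
apply: covered_step_succ; first by apply: step_BC; lra.
apply: covered_step_succ; first by apply: step_CA; lra.
(* The left end goes to [- b], inside the trap, and [r] becomes [4 * r]. *)
apply: (@covered_sub _ _ _ _ (lineA (- b - 1) (- (b + 4) / 3 + 4 * r))).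
  by apply: line_sub; lra.
rewrite -[j.+2]add1n; apply: (covered_line_split (v := - b / 2 - 1)).
  exact: covered_A_trap.
by apply: IH; [lra|move: rj; rewrite exprS; lra].
Qed.

Variable J : nat.
Hypothesis b_closeJ : `|b - 8| * 4 ^+ J <= 1.

(** The end [4 - b], where [v = 6], exceeds the fixed point [- (b + 4) / 3] by [2 / 3 * (8 - b)],
    hence by at most |b - 8|. *)
Lemma covered_A_middle : cov (lineA (- b - 1) (4 - b)) (3 * J) J.+2.
Proof.
have /andP[b1 b2] := b_bounds.
rewrite -[J.+2]add1n; apply: (covered_line_split (v := - b / 2 - 1)).
  exact: covered_A_trap.
apply: covered_sub (covered_A_below _ b_closeJ) => //.
apply: line_sub => //.
by have := ler_norm (8 - b); rewrite distrC; have := normr_ge0 (b - 8); lra.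
Qed.

(** The branch [6 - 4v] sends [[0, 1]] to [[2, 6]], inside the middle piece. *)
Lemma covered_A_left : cov (lineA (- b - 2) (- b - 1)) (3 * J) J.+2.
Proof.
have /andP[b1 b2] := b_bounds.
apply: covered_step; first by apply: step_AC; lra.
apply: covered_step; first by apply: step_CE; lra.
apply: covered_step; first by apply: step_EA; lra.
by apply: covered_sub covered_A_middle; apply: line_sub; lra.
Qed.

(** The branch [4v - 4c - 2] lands in [[0, 6]], made of the left and middle pieces. *)
Lemma covered_A_e : cov (lineA (- 3 / 2) 0) (3 * J) (J.+2 + J.+2).
Proof.
have /andP[b1 b2] := b_bounds.
apply: covered_step; first by apply: step_AB; lra.
apply: covered_step; first by apply: step_BC; lra.
apply: covered_step; first by apply: step_CE; lra.
apply: covered_step; first by apply: step_EA; lra.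
apply: covered_sub (covered_line_split covered_A_left covered_A_middle).
by apply: line_sub; lra.
Qed.

(** The branch [4v - 2c - 2] maps this piece onto [[2, 2c]], which meets the trap, the piece itself
    and the two pieces on its right. As the piece recurs only once, each return adds
    [1 + (2 * J + 4) + 1] words and the count is linear in [j]. *)
Lemma covered_A_c j : (j <= J)%N ->
  cov (lineA (- b / 2 - 1) (- 3 / 2)) (3 * j) (1 + j * (2 * J + 6)).
Proof.
have /andP[b1 b2] := b_bounds.
elim: j => [|j IH] jJ; first exact: covered0.
rewrite [(3 * j.+1)%N]mulnS -[3%N]/(1 + (1 + 1))%N -!addnA !add1n.
apply: covered_step_succ; first by apply: step_AB; lra.
apply: covered_step_succ; first by apply: step_BC; lra.
apply: covered_step_succ; first by apply: step_CA; lra.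
apply: (@covered_sub _ _ _ _ (lineA (- b - 1) (b - 2))).
  by apply: line_sub; lra.
apply: (@covered_leq_card _ _ _ _ _ (1 + ((1 + j * (2 * J + 6)) + (J.+2 + J.+2 + 1)))); first by lia.
apply: (covered_line_split (v := - b / 2 - 1)); first exact: covered_A_trap.
apply: (covered_line_split (v := - 3 / 2)); first by apply: IH; exact: ltnW.
apply: (covered_line_split (v := 0)); last exact: covered_A_right.
by apply: covered_leq_time covered_A_e; lia.
Qed.

(** Sum over the five branches of the return map. *)
Let Q := (2 * J ^ 2 + 9 * J + 9)%N.

Lemma covered_A : cov (lineA (- b - 2) (b - 2)) (3 * J) Q.
Proof.
apply: (@covered_leq_card _ _ _ _ _
  (J.+2 + (1 + ((1 + J * (2 * J + 6)) + (J.+2 + J.+2 + 1))))); first by rewrite /Q; lia.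
apply: (covered_line_split covered_A_left).
apply: (covered_line_split (v := - b / 2 - 1)); first exact: covered_A_trap.
apply: (covered_line_split (v := - 3 / 2)); first exact: covered_A_c.
by apply: (covered_line_split (v := 0)); [exact: covered_A_e|exact: covered_A_right].
Qed.

Lemma covered_E : cov (lineE (b - 2) (b + 4)) (3 * J) Q.
Proof.
have /andP[b1 b2] := b_bounds.
apply: covered_step; first by apply: step_EA; lra.
by apply: covered_sub covered_A; apply: line_sub; lra.
Qed.

Lemma covered_C : cov (lineC 0 (b + 2)) (3 * J) (Q + Q).
Proof.
have /andP[b1 b2] := b_bounds.
apply: (covered_line_split (v := b - 1)).
  apply: covered_step; first by apply: step_CA; lra.
  by apply: covered_sub covered_A; apply: line_sub; lra.
apply: covered_step; first by apply: step_CE; lra.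
by apply: covered_sub covered_E; apply: line_sub; lra.
Qed.

Lemma covered_B : cov (lineB (- b - 2) b) (3 * J) (Q + Q + 1).
Proof.
have /andP[b1 b2] := b_bounds.
apply: (covered_line_split (v := 0)).
  apply: covered_step; first by apply: step_BC; lra.
  by apply: covered_sub covered_C; apply: line_sub; lra.
by apply: (covered_step (step_BD _)) => //; exact: covered_D.
Qed.

End Pieces.

(** * An invariant set of counted pieces containing the graph *)

Section GraphLines.
Context {R : realType} (b : R).
Hypothesis b_near8 : `|b - 8| <= 1 / 4.

Definition graph_lines : set (R * R) :=
  lineA b (- b - 2) (b - 2) `|` lineB (- b - 2) b `|` lineC b 0 (b + 2) `|`
  lineD b 0 b `|` lineE b (b - 2) (b + 4).

Lemma covered_graph_lines J : `|b - 8| * 4 ^+ J <= 1 ->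
  covered (-1) b graph_lines (3 * J) (12 * (J ^ 2 + 5 * J + 5)).
Proof.
move=> bJ; have A := covered_A b_near8 bJ; have B := covered_B b_near8 bJ.
have C := covered_C b_near8 bJ; have E := covered_E b_near8 bJ.
have D := covered_D b_near8 b (3 * J) (lexx 0).
have := coveredU (coveredU (coveredU (coveredU A B) C) D) E.
(* The five counts add up to [6 * (2 * J ^ 2 + 9 * J + 9) + 2]. *)
by apply: covered_leq_card; lia.
Qed.

Lemma graph_lines_stable p : graph_lines p -> graph_lines (F (-1) b p).
Proof.
have /andP[b1 b2] := b_bounds b_near8.
have toA l u : - b - 2 <= l -> u <= b - 2 -> lineA b l u (F (-1) b p) -> graph_lines (F (-1) b p).
  by move=> ? ? h; do 4 left; apply: line_sub h.
have toB l u : - b - 2 <= l -> u <= b -> lineB l u (F (-1) b p) -> graph_lines (F (-1) b p).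
  by move=> ? ? h; do 3 left; right; apply: line_sub h.
have toC l u : 0 <= l -> u <= b + 2 -> lineC b l u (F (-1) b p) -> graph_lines (F (-1) b p).
  by move=> ? ? h; do 2 left; right; apply: line_sub h.
have toD l u : 0 <= l -> u <= b -> lineD b l u (F (-1) b p) -> graph_lines (F (-1) b p).
  by move=> ? ? h; left; right; apply: line_sub h.
have toE l u : b - 2 <= l -> u <= b + 4 -> lineE b l u (F (-1) b p) -> graph_lines (F (-1) b p).
  by move=> ? ? h; right; apply: line_sub h.
move=> [[[[]|]|]|].
- move=> /(line_split 0)[/(line_split (- b - 1))[]|].
  + by move=> /(step_AC b_near8)[]; [lra|lra|] => _; apply: toC; lra.
  + by move=> /(step_AB b_near8)[]; [lra|lra|] => _; apply: toB; lra.
  + by move=> /(step_AA b_near8)[]; [lra|] => _; apply: toA; lra.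
- move=> /(line_split 0)[].
  + by move=> /(step_BC b_near8)[]; [lra|] => _; apply: toC; lra.
  + by move=> /(step_BD b_near8)[]; [lra|] => _; apply: toD; lra.
- move=> /(line_split (b - 1))[].
  + by move=> /(step_CA b_near8)[]; [lra|lra|] => _; apply: toA; lra.
  + by move=> /(step_CE b_near8)[]; [lra|] => _; apply: toE; lra.
- by move=> /(step_DA b_near8)[]; [lra|] => _; apply: toA; lra.
- by move=> /(step_EA b_near8)[]; [lra|] => _; apply: toA; lra.
Qed.

Lemma graph_lines_bounded p : graph_lines p -> `|p| <= 20.
Proof.
have /andP[b1 b2] := b_bounds b_near8.
case: p => x y; rewrite prod_normE ge_max !ler_norml.
by move=> [[[[]|]|]|] [/= -> /andP[h1 h2]]; apply/andP; split; apply/andP; split; lra.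
Qed.

Lemma segment_line (s c x y x' y' : R) : y = s * x + c -> y' = s * x' + c ->
  x <= x' -> segment (x, y) (x', y') `<=` line s c x x'.
Proof.
move=> -> -> xx' _ [t /= + <-]; rewrite in_itv /= => /andP[t0 t1].
rewrite /line /= /GRing.scale /=; split; first by ring.
by apply/andP; split; nra.
Qed.

Lemma segmentC (p q : R * R) : segment p q `<=` segment q p.
Proof.
move=> _ [t /= + <-]; rewrite in_itv /= => /andP[t0 t1].
exists (1 - t); first by rewrite /= in_itv /=; apply/andP; split; lra.
by rewrite addrC; congr (_ *: _ + _ *: _); lra.
Qed.

Lemma normalized_graph_lines : normalized_graph b `<=` graph_lines.
Proof.
have /andP[b1 b2] := b_bounds b_near8.
move=> p [[[[]|]|]|].
- by move=> h; do 4 left; apply: segment_line h; lra.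
- by move=> h; do 3 left; right; apply: segment_line h; lra.
- by move=> /segmentC h; do 2 left; right; apply: segment_line h; lra.
- by move=> h; left; right; apply: segment_line h; lra.
- by move=> /segmentC h; right; apply: segment_line h; lra.
Qed.

End GraphLines.

(** * Cardinality of separated sets *)

Section Counting.
Context {R : realType}.

(** Pigeonhole: all values lie within [M] of the value at one point [x0], and each cell of length
    [eta] in that window holds at most one of them. *)
Lemma card_spread (T : choiceType) (E : {fset T}) (g : T -> R) (eta M : R) :
  0 < eta -> 0 <= M ->
  (forall x y, x \in E -> y \in E -> x != y -> eta < `|g x - g y| <= M) ->
  (#|` E|)%:R <= 2 * M / eta + 1.
Proof.
move=> eta0 M0 gE.
have [->|/fset0Pn[x0 x0E]] := eqVneq E fset0.
  by rewrite cardfs0; have := divr_ge0 M0 (ltW eta0); lra.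
pose h x := (g x - g x0 + M) / eta; pose k x := Num.truncn (h x).
have gM x : x \in E -> - M <= g x - g x0 <= M.
  move=> xE; rewrite -ler_norml; have [->|xx0] := eqVneq x x0.
    by rewrite subrr normr0.
  by have /andP[] := gE x x0 xE x0E xx0.
have h0 x : x \in E -> 0 <= h x.
  by move=> /gM /andP[h1 h2]; apply: divr_ge0; lra.
have kinj : {in E &, injective k}.
  move=> x y xE yE kxy; apply/eqP; apply: contraT => xy.
  have /andP[+ _] := gE x y xE yE xy.
  have /andP[] := truncn_itv (h0 x xE); have /andP[] := truncn_itv (h0 y yE).
  rewrite -/(k x) -/(k y) kxy => hy1 hy2 hx1 hx2.
  have : `|h x - h y| < 1.
    by rewrite ltr_norml; move: hy1 hy2 hx1 hx2; rewrite -natr1 => *; apply/andP; split; lra.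
  have -> : h x - h y = (g x - g y) / eta by rewrite /h; field; rewrite gt_eqF.
  by rewrite normrM normfV (gtr0_norm eta0) ltr_pdivrMr// mul1r => ? ?; lra.
have : (size [seq k x | x <- E] <= size (iota 0 (Num.truncn (2 * M / eta)).+1))%N.
  apply: uniq_leq_size; first by rewrite map_inj_in_uniq// fset_uniq.
  move=> _ /mapP[x xE ->]; rewrite mem_iota /= add0n ltnS; apply: le_truncn.
  by rewrite ler_pM2r ?invr_gt0//; have /andP[] := gM x xE; lra.
rewrite size_map size_iota -(ler_nat R) => /le_trans; apply.
by rewrite -natr1 lerD2r truncn_le divr_ge0 ?mulr_ge0// ltW.
Qed.

Lemma card_cover (T : choiceType) (I : eqType) (L : seq I) (A : I -> set T)
    (E : {fset T}) (m : R) :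
  (forall x, x \in E -> exists2 i, i \in L & A i x) ->
  (forall i (E' : {fset T}), i \in L -> (E' `<=` E)%fset -> [set` E'] `<=` A i ->
    (#|` E'|)%:R <= m) ->
  (#|` E|)%:R <= (size L)%:R * m.
Proof.
elim: L E => [|i L IH] E EL Em.
  have [->|/fset0Pn[x /EL[]]//] := eqVneq E fset0.
  by rewrite cardfs0 mul0r.
pose E1 := [fset x in E | `[< A i x >]]%fset.
have E1E : (E1 `<=` E)%fset by apply/fsubsetP => x; rewrite !inE => /andP[].
rewrite -(cardfsID E1) (fsetIidPr E1E) natrD /= -natr1 mulrDl mul1r addrC.
apply: lerD.
  apply: IH => [x|j E' jL E'E]; last first.
    by apply: Em; rewrite ?inE ?jL ?orbT// (fsubset_trans E'E)// fsubsetDl.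
  rewrite !inE => /andP[+ xE]; rewrite xE /= => /asboolPn nA.
  have [j + Aj] := EL _ xE; rewrite inE => /orP[/eqP ji|jL]; last by exists j.
  by rewrite ji in Aj.
apply: (Em i) => //; first by rewrite inE eqxx.
by move=> x /=; rewrite !inE => /andP[_ /asboolP].
Qed.

Context (a b : R).

(* All iterates up to time [n] are affine in the abscissa on the set, so that
   the sum of the distances between iterates is the distance between the
   values of a single linear function of the abscissa. *)
Lemma card_separated_affine (s c eta M : R) w (E : {fset R * R}) n :
  0 < eta -> 0 <= M -> size w = n ->
  (forall p, p \in E -> p.2 = s * p.1 + c /\ follows a b w p) ->
  (forall p q i, p \in E -> q \in E -> `|iter i (F a b) p - iter i (F a b) q| <= M) ->
  Defs.separated (F a b) n eta E ->
  (#|` E|)%:R <= 2 * (n%:R * M) / eta + 1.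
Proof.
move=> eta0 M0 wn Ew EM sepE.
(* The factor by which the [i]-th iterate stretches differences of abscissas. *)
pose v i := `|foldl (fun e o => quadrant_linear o e) (1, s) (take i w)|.
pose V := \sum_(i < n) v i.
have V0 : 0 <= V by apply: sumr_ge0 => i _; exact: normr_ge0.
have dist p q i : p \in E -> q \in E -> (i <= n)%N ->
    `|iter i (F a b) p - iter i (F a b) q| = `|p.1 - q.1| * v i.
  move=> pE qE iin; have [p2 wp] := Ew _ pE; have [q2 wq] := Ew _ qE.
  rewrite -normrZ; congr `|_|; apply: iter_follows wp wq _ _; last by rewrite wn.
  case: p q p2 q2 {pE qE} => [p1 p2] [q1 q2] /= -> ->.
  by apply/pair_equal_spec; split; rewrite /GRing.scale /=; ring.
apply: (@card_spread _ _ (fun p => p.1 * V)) => [//||p q pE qE pq].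
  by rewrite mulr_ge0.
rewrite -mulrBl normrM (ger0_norm V0); apply/andP; split.
  apply: (lt_le_trans (sepE _ _ pE qE pq)); apply: bigmax_le.
    by rewrite mulr_ge0.
  move=> i _; rewrite dist ?(ltnW (ltn_ord i))// ler_wpM2l//.
  by rewrite /V (bigD1 i)//= lerDl sumr_ge0// => j _; exact: normr_ge0.
rewrite mulr_sumr; apply: (@le_trans _ _ (\sum_(i < n) M)).
  by apply: ler_sum => i _; rewrite -dist ?EM// ltnW.
by rewrite sumr_const card_ord mulr_natl.
Qed.

End Counting.

(** * General bounds on topological entropy *)

Section EntropyBounds.
Context {R : realType}.

Lemma sep_number_ge0 (T : normedModType R) (f : T -> T) K n (eta : R) :
  (0 <= sep_number f K n eta)%E.
Proof.
apply: ereal_sup_ubound; exists fset0; last by rewrite cardfs0.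
by split=> [x|x y] /=; rewrite inE.
Qed.

(** A singleton is separated, so the logarithms are nonnegative. *)
Lemma topological_entropy_ge0 (T : normedModType R) (f : T -> T) K :
  K !=set0 -> (0 <= topological_entropy f K)%E.
Proof.
move=> [x Kx]; apply: (@le_trans _ _ (entropy_at f K 1)); last first.
  by apply: ereal_sup_ubound; exists 1 => //=.
apply: limf_esup_ge0 => [|n]; first exact: filter_not_empty.
apply: mule_ge0; first by rewrite lee_fin invr_ge0.
rewrite lne_ge0; apply: ereal_sup_ubound; exists [fset x]%fset; last by rewrite cardfs1.
by split=> [y|y z] /=; rewrite !inE => /eqP -> // /eqP ->; rewrite eqxx.
Qed.

Lemma topological_entropy_le (T : normedModType R) (f : T -> T) K (tau : R) :
  (forall eta, 0 < eta -> exists2 C, 0 < C &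
    forall n, (sep_number f K n eta <= (C * expR (tau * n%:R))%:E)%E) ->
  (topological_entropy f K <= tau%:E)%E.
Proof.
move=> grow; apply: ge_ereal_sup => _ [eta /= eta0 <-].
have [C C0 sepC] := grow _ eta0.
apply/lee_addgt0Pr => e e0; rewrite /entropy_at /limn_esup limf_esupE.
(* From [N] on, [ln C / n <= e]; the successor also excludes [n = 0]. *)
pose N := (Num.truncn (`|ln C| / e)).+1.
apply: ge_ereal_inf; exists (ereal_sup [set ((n%:R^-1)%:E * lne (sep_number f K n eta))%E
    | n in [set n | (N <= n)%N]]).
  by exists [set n | (N <= n)%N] => //; exact: nbhs_infty_ge.
apply: ge_ereal_sup => _ [n /= Nn <-].
have n0 : (0 < n%:R :> R) by rewrite ltr0n (leq_trans _ Nn).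
have ClnC : ln C <= e * n%:R.
  have : `|ln C| / e < N%:R by exact: truncnS_gt.
  rewrite ltr_pdivrMr// mulrC => /ltW h; apply: (le_trans (ler_norm _)).
  by apply: (le_trans h); rewrite ler_wpM2l ?(ltW e0)// ler_nat.
apply: (@le_trans _ _ ((n%:R^-1)%:E * (ln C + tau * n%:R)%:E)%E).
  rewrite lee_wpmul2l ?lee_fin ?invr_ge0 ?(ltW n0)//.
  rewrite -(expRK (tau * _)) -lnM ?posrE ?expR_gt0// -lne_EFin ?mulr_gt0 ?expR_gt0//.
  rewrite lee_lne ?sepC// in_itv /= leey andbT ?sep_number_ge0//.
  by rewrite lee_fin mulr_ge0 ?expR_ge0 ?ltW.
rewrite -EFinM -EFinD lee_fin ler_pdivrMl//; lra.
Qed.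

(** Scaling turns [eta]-separated sets into [lam * eta]-separated ones of the same size, and the
    supremum over all [eta] absorbs the factor. *)
Lemma homothety_entropy_le (T : normedModType R) (f g : T -> T) K (lam : R) :
  0 < lam -> (forall x, g (lam *: x) = lam *: f x) ->
  (topological_entropy f K <= topological_entropy g [set lam *: x | x in K])%E.
Proof.
move=> lam0 gf; have lamn0 : lam != 0 by rewrite gt_eqF.
have iterg i x : iter i g (lam *: x) = lam *: iter i f x.
  by elim: i => //= i ->; rewrite gf.
have bowen n x y : bowen_dist g n (lam *: x) (lam *: y) = lam * bowen_dist f n x y.
  rewrite /bowen_dist (big_morph ( *%R lam) (op1 := Num.max) (id1 := 0)) ?mulr0//.
    by apply: eq_bigr => i _; rewrite !iterg -scalerBr normrZ (gtr0_norm lam0).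
  by move=> u v; rewrite maxr_pMr// ltW.
apply: ge_ereal_sup => _ [eta /= eta0 <-].
apply: (@le_trans _ _ (entropy_at g [set lam *: x | x in K] (lam * eta))); last first.
  by apply: ereal_sup_ubound; exists (lam * eta) => //=; rewrite mulr_gt0.
have sep_le n : (sep_number f K n eta <=
    sep_number g [set lam *: x | x in K] n (lam * eta))%E.
  apply: ge_ereal_sup => _ [E [EK sepE] <-]; apply: ereal_sup_ubound.
  exists [fset lam *: x | x in E]%fset; last first.
    by rewrite card_imfset//; exact: scalerI.
  split=> [_ /= /imfsetP[x /= xE ->]|_ _ /imfsetP[x /= xE ->] /imfsetP[y /= yE ->]].
    by exists x => //; exact: EK.
  rewrite bowen ltr_pM2l// => xy; apply: sepE => //.
  by apply: contraNneq xy => ->.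
rewrite /entropy_at /limn_esup !limf_esupE.
apply/ereal_infP => _ [V Voo <-]; apply: ge_ereal_inf.
exists (ereal_sup [set ((n%:R^-1)%:E * lne (sep_number f K n eta))%E | n in V]).
  by exists V.
apply: ge_ereal_sup => _ [n Vn <-]; apply: le_trans (ereal_sup_ubound _); last first.
  by exists n.
rewrite lee_wpmul2l ?lee_fin ?invr_ge0//.
by rewrite lee_lne// in_itv /= leey andbT sep_number_ge0.
Qed.

End EntropyBounds.

(** * Entropy for parameters near 8 *)

Section Near8.
Context {R : realType}.

Lemma sep_number_graph_lines (b eta : R) n k : `|b - 8| <= 1 / 4 -> 0 < eta ->
  covered (-1) b (graph_lines b) n k ->
  (sep_number (F (-1) b) (graph_lines b) n eta <=
    ((5 * k)%:R * (80 / eta * n%:R + 1))%:E)%E.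
Proof.
move=> b8 eta0 [L [Lk Ln LG]].
have M0 : 0 <= 80 / eta * n%:R + 1.
  by rewrite addr_ge0// mulr_ge0// divr_ge0// ltW.
apply: ge_ereal_sup => _ [E [EG sepE] <-]; rewrite lee_fin.
(* Slopes and intercepts; pairing a line with a word gives at most [5 * k] classes. *)
pose lines := [:: (1, b + 1); (0, -1); (-1, b - 1); (1, b - 1); (0, 2 * b - 1)] : seq (R * R).
pose A (i : R * R * seq (bool * bool)) : set (R * R) :=
  [set p | p.2 = i.1.1 * p.1 + i.1.2 /\ follows (-1) b i.2 p].
pose LL := [seq (l, w) | l <- lines, w <- L].
apply: (@le_trans _ _ ((size LL)%:R * (80 / eta * n%:R + 1))); last first.
  by rewrite ler_wpM2r// ler_nat size_allpairs leq_mul2l Lk orbT.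
apply: (@card_cover _ _ _ LL A) => [p pE|[[s c] w] E'].
  have Gp := EG p pE; have [w wL wp] := LG _ Gp.
  have [l ll pl] : exists2 l, l \in lines & p.2 = l.1 * p.1 + l.2.
    case: Gp => [[[[]|]|]|] [-> _].
    - by exists (1, b + 1); rewrite ?inE ?eqxx ?orbT.
    - by exists (0, -1); rewrite ?inE ?eqxx ?orbT.
    - by exists (-1, b - 1); rewrite ?inE ?eqxx ?orbT.
    - by exists (1, b - 1); rewrite ?inE ?eqxx ?orbT.
    - by exists (0, 2 * b - 1); rewrite ?inE ?eqxx ?orbT.
  by exists (l, w) => //; apply/allpairsP; exists (l, w).
move=> /allpairsP[[l w'] /= [_ wL [_ ->]]] E'E E'A.
(* Norms are at most 20, so distances are at most 40. *)
have -> : 80 / eta * n%:R + 1 = 2 * (n%:R * 40) / eta + 1 by field; rewrite gt_eqF.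
apply: (@card_separated_affine _ (-1) b s c _ _ w') => //.
- exact: Ln.
- move=> p q i pE qE; apply: (le_trans (ler_normB _ _)).
  have h z : z \in E' -> `|iter i (F (-1) b) z| <= 20.
    move=> zE; apply: (graph_lines_bounded b8).
    by apply: iter_stable; [exact: graph_lines_stable|apply: EG; exact: (fsubsetP E'E)].
  by have := h _ pE; have := h _ qE; lra.
- by move=> p q pE qE; apply: sepE; exact: (fsubsetP E'E).
Qed.

Lemma sep_number_mono (T : normedModType R) (f : T -> T) K K' n (eta : R) :
  K `<=` K' -> (sep_number f K n eta <= sep_number f K' n eta)%E.
Proof.
move=> KK'; apply: ereal_sup_le => _ [E [EK sepE] <-]; exists E => //.
by split=> //; exact: subset_trans KK'.
Qed.

Lemma exists_quadratic_le_expR (e : R) : 0 < e ->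
  exists J, (0 < J)%N /\ (12 * (J ^ 2 + 5 * J + 5))%:R <= expR (e * (3 * J)%:R).
Proof.
(* For [J >= 1] the quadratic is at most [132 * J ^ 2], hence at most [(e * J) ^ 3], which the cube
   of [expR (e * J)] dominates. *)
move=> e0; pose J := (Num.truncn (132 / e ^+ 3)).+1; exists J; split=> //.
have JE : 132 <= J%:R * e ^+ 3.
  by rewrite -ler_pdivrMr ?exprn_gt0// ltW// truncnS_gt.
have J1 : 1 <= J%:R :> R by rewrite ler1n.
move: (J) JE J1 => {}J JE J1.
have -> : e * (3 * J)%:R = 3%:R * (e * J%:R) by rewrite natrM; ring.
rewrite expRM_natl; apply: (@le_trans _ _ ((e * J%:R) ^+ 3)); last first.
  rewrite lerXn2r ?nnegrE ?expR_ge0 ?mulr_ge0 ?(ltW e0)//.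
  by apply: le_trans (expR_ge1Dx _); rewrite lerDr.
rewrite exprMn !(natrM, natrD, natrX); move: JE J1; set x := J%:R; set y := e ^+ 3.
by move=> h1 h2; have := ler_wpM2r (sqr_ge0 x) h1; nra.
Qed.

Lemma entropy_le_near8 (e : R) : 0 < e -> exists2 delta, 0 < delta &
  forall b : R, `|b - 8| < delta ->
    (topological_entropy (F (-1) b) (normalized_graph b) <= e%:E)%E.
Proof.
(* One half of [e] bounds the growth of the number of words, the other absorbs the factor linear in
   [n]. *)
move=> e0; have e20 : 0 < e / 2 by lra.
have [J [J0 kJ]] := exists_quadratic_le_expR e20.
exists (Num.min (1 / 4) (4 ^- J)); first by rewrite lt_min invr_gt0 exprn_gt0//; lra.
move=> b; rewrite lt_min => /andP[/ltW b8 bJ].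
have {}bJ : `|b - 8| * 4 ^+ J <= 1.
  by rewrite -ler_pdivlMr ?exprn_gt0// mul1r ltW.
have covJ := covered_graph_lines b8 bJ.
move: kJ covJ; set k := (12 * _)%N; set m := (3 * J)%N => kJ covJ.
have m0 : (0 < m)%N by rewrite muln_gt0.
apply: topological_entropy_le => eta eta0.
have c0 : 0 < 80 / eta by apply: divr_gt0.
exists (5 * expR (e / 2 * m%:R) * (80 / eta / (e / 2) + 1)).
  by rewrite !mulr_gt0 ?expR_gt0// addr_gt0// divr_gt0.
move=> n; have GG := normalized_graph_lines b8.
apply: (le_trans (sep_number_mono _ _ _ GG)).
(* Time [n] is rounded up to a multiple of [m]. *)
have covn : covered (-1) b (graph_lines b) n (k ^ (n %/ m).+1).
  apply: covered_leq_time (covered_mul _ _ covJ); last exact: graph_lines_stable.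
  by rewrite ltnW// -ltn_divLR.
apply: (le_trans (sep_number_graph_lines b8 eta0 covn)); rewrite lee_fin.
have kn : (k ^ (n %/ m).+1)%:R <= expR (e / 2 * m%:R) * expR (e / 2 * n%:R) :> R.
  rewrite natrX; apply: (@le_trans _ _ (expR (e / 2 * m%:R) ^+ (n %/ m).+1)).
    by rewrite lerXn2r ?nnegrE ?expR_ge0.
  rewrite -expRM_natl -expRD ler_expR -mulrDr mulrCA ler_wpM2l ?(ltW e20)//.
  by rewrite -natrM -natrD ler_nat mulSn leq_add2l leq_trunc_div.
have nn : 80 / eta * n%:R + 1 <= (80 / eta / (e / 2) + 1) * expR (e / 2 * n%:R).
  apply: (@le_trans _ _ ((80 / eta / (e / 2) + 1) * (1 + e / 2 * n%:R))); last first.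
    rewrite ler_wpM2l ?expR_ge1Dx// addr_ge0// divr_ge0// ltW//.
  have -> : 80 / eta * n%:R = (80 / eta / (e / 2)) * (e / 2 * n%:R).
    by field; rewrite !gt_eqF.
  have : 0 <= e / 2 * n%:R by rewrite mulr_ge0// ltW.
  have : 0 <= 80 / eta / (e / 2) by rewrite divr_ge0// ltW.
  by nra.
have -> : e * n%:R = e / 2 * n%:R + e / 2 * n%:R by lra.
have nn0 : 0 <= 80 / eta * n%:R + 1 by rewrite addr_ge0// mulr_ge0// ltW.
have := ler_pM (ler0n _ _) nn0 kn nn.
by rewrite natrM expRD; lra.
Qed.

(** The homothety of ratio [- a] gives one inequality, its inverse the other. *)
Lemma entropy_graph (a b c : R) : a < 0 -> c = - b / a ->
  topological_entropy (F a b) (graph a b) =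
  topological_entropy (F (-1) c) (normalized_graph c).
Proof.
move=> a0 cE; have na0 : 0 < - a by rewrite oppr_gt0.
have FZ p : F a b (- a *: p) = - a *: F (-1) c p.
  rewrite cE /F /= /GRing.scale /= !normrM !(gtr0_norm na0).
  by apply/pair_equal_spec; split; rewrite /GRing.scale /=; [ring|field; rewrite lt_eqF].
rewrite /graph (ltr0_norm a0) -cE; apply/eqP; rewrite eq_le; apply/andP; split; last first.
  exact: homothety_entropy_le.
set K := normalized_graph _; set K' := [set _ | _ in _].
have na_neq0 : - a != 0 by rewrite gt_eqF.
have -> : K = [set (- a)^-1 *: p | p in K'].
  apply/seteqP; split=> [p Kp|_ [_ [p Kp <-] <-]]; last by rewrite scalerK.
  by exists (- a *: p); [exists p|rewrite scalerK].
apply: homothety_entropy_le => [|p]; first by rewrite invr_gt0.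
by rewrite -[in RHS](scalerKV na_neq0 p) FZ scalerK.
Qed.

End Near8.

Theorem theorem1 (R : realType) (a : R) (a_lt0 : a < 0) (hF : R -> \bar R)
    (hFE : forall b : R, 4 < - b / a ->
       hF (- b / a) = topological_entropy (F a b) (graph a b)) :
  (forall a' b' : R, a' < 0 -> 4 < - b' / a' ->
     topological_entropy (F a' b') (graph a' b') = hF (- b' / a')) /\
  {for 8, continuous hF}.
Proof.
have hFc c : 4 < c -> hF c = topological_entropy (F (-1) c) (normalized_graph c).
  have [b cE] : exists b, c = - b / a.
    by exists (- (c * a)); rewrite opprK mulfK// lt_eqF.
  move=> c4; rewrite -(entropy_graph a_lt0 cE) cE; apply: hFE.
  by rewrite -cE.
split=> [a' b' a'0 c4|].
  by rewrite (hFc _ c4) (entropy_graph a'0 erefl).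
have hF0 c : 4 < c -> (0 <= hF c)%E.
  move=> c4; rewrite hFc//; apply: topological_entropy_ge0.
  exists (P3 c); do 4 left; exists 0; first by rewrite /= in_itv /= lexx ler01.
  by rewrite subr0 scale1r scale0r addr0.
have hFle e : 0 < e -> \forall c \near (8 : R), 4 < c /\ (hF c <= e%:E)%E.
  move=> e0; have [delta delta0 hdelta] := entropy_le_near8 e0.
  have d0 : 0 < Num.min delta 4 by rewrite lt_min delta0 ltr0n.
  near=> c; have : `|8 - c| < Num.min delta 4 by near: c; exact: cvgr_dist_lt.
  rewrite lt_min distrC => /andP[h1 h2].
  have c4 : 4 < c by move: h2; rewrite ltr_norml => /andP[]; lra.
  by split=> //; rewrite hFc//; exact: hdelta.
(* The bound by every [e > 0] holds at 8 itself. *)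
have hF8 : hF 8 = 0%:E.
  have h48 : 4 < 8 :> R by lra.
  apply/eqP; rewrite eq_le hF0// andbT; apply/lee_addgt0Pr => e e0; rewrite add0e.
  by have [] := nbhs_singleton (hFle _ e0).
(* Convergence to a finite limit in [\bar R]: finite values nearby, then convergence of the real
   parts. *)
rewrite /prop_for /continuous_at hF8; apply/fine_cvgP; split.
  near=> c; have [c4 hc] : 4 < c /\ (hF c <= 1%:E)%E by near: c; exact: hFle.
  by rewrite ge0_fin_numE ?hF0// (le_lt_trans hc)// ltry.
apply/cvgrPdist_le => e e0; near=> c.
have [c4 hc] : 4 < c /\ (hF c <= e%:E)%E by near: c; exact: hFle.
rewrite sub0r normrN /= ger0_norm ?fine_ge0 ?hF0//.
rewrite -lee_fin fineK// ge0_fin_numE ?hF0//.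
by rewrite (le_lt_trans hc)// ltry.
Unshelve. all: by end_near.
Qed.
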